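(* Let $\nu^{0l}\in\mathbb C^{2n}$ be a common eigenvector of the matrices $A_k$ corresponding to the eigenvalues $\lambda_l^k$, $k=1,\ldots,2m$, and let $\nu^{\eta l}$, $\eta=1,\ldots,s_l-1$, be generalized eigenvectors of order $\eta$ of $A_\zeta$ corresponding to the eigenvalue $\lambda_l^\zeta$ with elementary divisor of multiplicity $s_l\ge2$. Let $\Psi_{\eta l}^\zeta\colon\Omega\to\mathbb C$, $\eta=1,\ldots,s_l-1$, be the solution of the system $$\nu^{\eta l}\gamma=\sum_{\delta=1}^{\eta}\binom{\eta-1}{\delta-1}\Psi_{\delta l}^\zeta(w)\,\nu^{\eta-\delta,l}\gamma,\quad \eta=1,\ldots,s_l-1,$$ on a domain $\Omega\subset\{w\colon\nu^{0l}\gamma\ne0\}$. Assume that none of the functions $w\to\mathfrak x_k\Psi^\zeta_{\eta l}(w)$, $k=1,\ldots,2m$, $k\ne\zeta$, $\eta=1,\ldots,s_l-1$, is a (nonconstant) first integral of the ordinary differential system $(1.1.\zeta)$ described in the context. Then the completely solvable system $dw=X_1(w)dz+X_2(w)d\overline z$ has the $\mathbb R$-differentiable first integrals $$F_\eta\colon(z,w)\to\Psi^\zeta_{\eta l}(w)-\sum_{j=1}^m\bigl(\mu_{\eta l}^{j\zeta}z_j+\mu_{\eta l}^{m+j,\zeta}\,\overline z_j\bigr)\quad\text{for all }(z,w)\in G,\quad\eta=1,\ldots,s_l-1,$$ where $G\subset\mathbb C^m\times\Omega\subset\mathbb C^{m+n}$ is a domain and the numbers $\mu_{\eta l}^{k\zeta}=\mathfrak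 x_k\Psi^\zeta_{\eta l}(w)$, $\eta=1,\ldots,s_l-1$, $k=1,\ldots,2m$.
   Context: Let $m,n\ge 1$, $w=(w_1,\ldots,w_n)\in\mathbb C^n$, $z=(z_1,\ldots,z_m)\in\mathbb C^m$, columns. Consider $dw=X_1(w)\,dz+X_2(w)\,d\overline z$, where $X_1(w)=\|X_{\tau j}(w)\|$, $X_2(w)=\|X_{\tau,m+j}(w)\|$ ($\tau=1,\ldots,n$, $j=1,\ldots,m$) and $X_{\tau k}(w)=\sum_{\xi=1}^n\bigl(a_{\tau k\xi}w_\xi+a_{\tau k,n+\xi}\overline w_\xi\bigr)$, $k=1,\ldots,2m$, with constants $a_{\tau k\varrho}\in\mathbb C$. The associated operators are, for $j=1,\ldots,m$, $$\mathfrak x_j(w)=\sum_{\xi=1}^n\bigl(X_{\xi j}(w)\partial_{w_\xi}+\overline{X_{\xi,m+j}(w)}\,\partial_{\overline w_\xi}\bigr),\qquad \mathfrak x_{m+j}(w)=\sum_{\xi=1}^n\bigl(X_{\xi,m+j}(w)\partial_{w_\xi}+\overline{X_{\xi j}(w)}\,\partial_{\overline w_\xi}\bigr).$$ The system is assumed completely solvable: $[\mathfrak x_k,\mathfrak x_l]=0$ on $\mathbb C^n$ for all $k,l=1,\ldots,2m$. The $2n\times 2n$ matrices are given by columns: $A_j=\|a_{1j}\ldots a_{nj}\,\overline a_{1,m+j}\ldots\overline a_{n,m+j}\|$, $A_{m+j}=\|a_{1,m+j}\ldots a_{n,m+j}\,\overline a_{1j}\ldots\overline a_{nj}\|$, $j=1,\ldots,m$,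 where $a_{\tau k}$ is the column $(a_{\tau k1},\ldots,a_{\tau k,2n})$ and $\overline a_{\tau k}$ is the column $(\overline{a_{\tau k,n+1}},\ldots,\overline{a_{\tau k,2n}},\overline{a_{\tau k1}},\ldots,\overline{a_{\tau kn}})$. Complete solvability is equivalent to $A_kA_l=A_lA_k$ for all $k,l$. Put $\gamma=(w_1,\ldots,w_n,\overline w_1,\ldots,\overline w_n)$ and $\nu\gamma=\sum_{\varrho=1}^{2n}\nu_\varrho\gamma_\varrho$ for $\nu\in\mathbb C^{2n}$. The index $\zeta\in\{1,\ldots,m\}$ is fixed so that $A_\zeta$ has the smallest number of elementary divisors; $(1.1.\zeta)$ is the system $dw_\tau=X_{\tau\zeta}(w)dz_\zeta+X_{\tau,m+\zeta}(w)d\overline z_\zeta$, $\tau=1,\ldots,n$, and a first integral of it here means a nonconstant function annihilated by $\mathfrak x_\zeta$. If $\nu^{0l}$ is an eigenvector of $A_\zeta$ for the eigenvalue $\lambda_l^\zeta$ with elementary divisor of multiplicity $s_l$, a nonzero vector $\nu^{\eta l}\in\mathbb C^{2n}$ is a generalized eigenvector of order $\eta$ if $(A_\zeta-\lambda_l^\zeta E)\nu^{\eta l}=\eta\,\nu^{\eta-1,l}$, $\eta=1,\ldots,s_l-1$ ($E$ the identity matrix). Put $\mathfrak X_j(z,w)=\partial_{z_j}+\mathfrak x_j(w)$, $\mathfrak X_{m+j}(z,w)=\partial_{\overline z_j}+\mathfrak x_{m+j}(w)$, $j=1,\ldots,m$. An $\mathbb R$-differentiable function (continuously differentiable in the real and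 imaginary parts) $F(z,w)$ is a first integral of the full system on a domain $G$ if $\mathfrak X_kF=0$ on $G$, $k=1,\ldots,2m$. *)

(* Defs.v *)
From HB Require Import structures.
From mathcomp Require Import all_boot all_order all_algebra.
From mathcomp Require Import complex finmap.
From mathcomp Require Import all_classical all_reals all_analysis.
Import Order.TTheory GRing.Theory Num.Theory.
Import numFieldNormedType.Exports.

Set Implicit Arguments.
Unset Strict Implicit.
Unset Printing Implicit Defensive.

Local Open Scope classical_set_scope.
Local Open Scope ring_scope.

(* The modulus topology on R[i]: the library declares it only on the alias
   R[i]^o.  It induces the usual topology of C^N on 'cV[R[i]]_N. *)
#[non_forgetful_inheritance]
HB.instance Definition _ (R : realType) := NormedModule.copy R[i] R[i]^o.

Section RealDifferentiation.
Context {R : realType} {N : nat}.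
Implicit Types (f : 'cV[R[i]]_N -> R[i]) (v w : 'cV[R[i]]_N) (i : 'I_N).

Definition line_re f v w (t : R) : R := complex.Re (f (w + t%:C%C *: v)).
Definition line_im f v w (t : R) : R := complex.Im (f (w + t%:C%C *: v)).

Definition partial v f w : R[i] :=
  Complex (derive1 (line_re f v w) 0) (derive1 (line_im f v w) 0).

(* With w_i = x_i + 'i * y_i, the directions of x_i and y_i. *)
Definition dir_x i : 'cV[R[i]]_N := delta_mx i 0.
Definition dir_y i : 'cV[R[i]]_N := 'i%C *: delta_mx i 0.

Definition d_w i f w : R[i] :=
  2%:R^-1 * (partial (dir_x i) f w - 'i%C * partial (dir_y i) f w).
Definition d_wbar i f w : R[i] :=
  2%:R^-1 * (partial (dir_x i) f w + 'i%C * partial (dir_y i) f w).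

Definition C1_along v f w : Prop :=
  [/\ derivable (line_re f v w) 0 1, derivable (line_im f v w) 0 1
    & {for w, continuous (partial v f)}].

Definition Rdifferentiable (U : set 'cV[R[i]]_N) f : Prop :=
  forall w, U w -> forall i, C1_along (dir_x i) f w /\ C1_along (dir_y i) f w.

Definition twice_Rdifferentiable (U : set 'cV[R[i]]_N) f : Prop :=
  Rdifferentiable U f /\
  forall i, Rdifferentiable U (partial (dir_x i) f) /\
            Rdifferentiable U (partial (dir_y i) f).

Definition is_domain (U : set 'cV[R[i]]_N) : Prop :=
  [/\ U !=set0, open U & connected U].

End RealDifferentiation.

Section ElementaryDivisors.
Context {F : closedFieldType} {N : nat}.
Implicit Type A : 'M[F]_N.

(* Gcd of the k x k minors of 'X%:M - A (non-injective f, g give zero minors). *)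
Definition determinantal_divisor A (k : nat) : {poly F} :=
  \big[@gcdp F/0]_(fg : {ffun 'I_k -> 'I_N} * {ffun 'I_k -> 'I_N})
     \det (mxsub fg.1 fg.2 (char_poly_mx A)).

Definition invariant_factor A (k : 'I_N) : {poly F} :=
  determinantal_divisor A k.+1 %/ determinantal_divisor A k.

(* ('X - l)^s is an elementary divisor: it is the exact power of 'X - l in one
   of the invariant factors. *)
Definition elementary_divisor A (l : F) (s : nat) : Prop :=
  (0 < s)%N /\ exists k : 'I_N, mup l (invariant_factor A k) = s.

(* Elementary divisors counted with repetition correspond to the pairs (k, l)
   with l a root of the k-th invariant factor. *)
Definition nb_elementary_divisors A : nat :=
  #|` fset_set [set kl : 'I_N * F | root (invariant_factor A kl.1) kl.2] |.

End ElementaryDivisors.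

Section LinearSystem.
Context {R : realType} {m n : nat}.
Local Notation C := R[i].

(* Indices k : 'I_(m + m): lshift m j stands for j, rshift m j for m + j. *)
Definition swap_index (k : 'I_(m + m)) : 'I_(m + m) :=
  match fintype.split k with inl j => rshift m j | inr j => lshift m j end.

Definition gamma (w : 'cV[C]_n) : 'cV[C]_(n + n) := col_mx w (map_mx Num.conj w).

Definition linform (nu : 'cV[C]_(n + n)) (w : 'cV[C]_n) : C :=
  \sum_r nu r 0 * gamma w r 0.

Variable a : 'I_n -> 'I_(m + m) -> 'cV[C]_(n + n).

Definition coefX (tau : 'I_n) (k : 'I_(m + m)) (w : 'cV[C]_n) : C :=
  \sum_(xi < n) (a tau k (lshift n xi) 0 * w xi 0 +
                 a tau k (rshift n xi) 0 * (w xi 0)^*).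

Definition op_x (k : 'I_(m + m)) (f : 'cV[C]_n -> C) (w : 'cV[C]_n) : C :=
  \sum_(xi < n) (coefX xi k w * d_w xi f w +
                 (coefX xi (swap_index k) w)^* * d_wbar xi f w).

Definition completely_solvable : Prop :=
  forall k l (f : 'cV[C]_n -> C), twice_Rdifferentiable setT f ->
  forall w, op_x k (op_x l f) w - op_x l (op_x k f) w = 0.

Definition conj_col (v : 'cV[C]_(n + n)) : 'cV[C]_(n + n) :=
  col_mx (map_mx Num.conj (dsubmx v)) (map_mx Num.conj (usubmx v)).

Definition mxA (k : 'I_(m + m)) : 'M[C]_(n + n) :=
  row_mx (\matrix_(r, tau) a tau k r 0)
         (\matrix_(r, tau) conj_col (a tau (swap_index k)) r 0).

(* First integral of dw = X_{. zeta} dz_zeta + X_{., m + zeta} d(conj z_zeta);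
   constants are excluded. *)
Definition ode_first_integral (zeta : 'I_m) (U : set 'cV[C]_n)
    (f : 'cV[C]_n -> C) : Prop :=
  [/\ Rdifferentiable U f,
      forall w, U w -> op_x (lshift m zeta) f w = 0
    & ~ exists c, forall w, U w -> f w = c].

(* A point (z, w) of C^m x C^n is encoded as col_mx z w. *)
Definition op_X (k : 'I_(m + m)) (F : 'cV[C]_(m + n) -> C) (p : 'cV[C]_(m + n)) : C :=
  match fintype.split k with
  | inl j => d_w (lshift n j) F p
  | inr j => d_wbar (lshift n j) F p
  end + op_x k (fun w => F (col_mx (usubmx p) w)) (dsubmx p).

Definition first_integral (G : set 'cV[C]_(m + n)) (F : 'cV[C]_(m + n) -> C) : Prop :=
  Rdifferentiable G F /\ forall k p, G p -> op_X k F p = 0.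

End LinearSystem.

(* Main.v *)
Require Import Defs.
From mathcomp Require Import all_boot all_order all_algebra.
From mathcomp Require Import complex ring.
From mathcomp Require Import all_classical all_reals all_analysis.
Import Order.TTheory GRing.Theory Num.Theory.
Import numFieldNormedType.Exports.
Local Open Scope classical_set_scope.
Local Open Scope ring_scope.

(** The operators [op_x a k] are first-order derivations, and on linear forms
    they act through the matrices: [op_x a k (linform nu)] is the linear form of
    [mxA a k *m nu] ([op_x_linform]).  Two consequences follow.

    First, testing complete solvability on linear forms shows that the matrices
    commute ([completely_solvable_commute]).  Conversely, as soon as the matrices
    commute, the operators commute on linear forms, and since the commutator of
    two derivations is a derivation they commute on everything obtained from
    linear forms by sums, products and inverses ([commuting_add],
    [commuting_mul], [commuting_inv]).  The system defining the [Psi eta] is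
    triangular with [linform (nu 0)], which does not vanish on [Omega], on its
    diagonal; each [Psi eta] is therefore such a function ([commuting_Psi]).

    Second, applying the operator of index [zeta] to the defining system and
    using [A nu_eta = lambda nu_eta + eta nu_(eta-1)] gives, by induction on [eta],
    the value 1 on [Psi 1] and 0 on every later [Psi eta] ([op_x_Psi]).

    Hence [x_zeta (x_k Psi) = x_k (x_zeta Psi) = 0]: the function [x_k Psi] is
    annihilated by [x_zeta] and regular on [Omega], so that, not being a
    nonconstant first integral of the ordinary system, it is a constant [mu].
    Subtracting from [Psi] the real-linear function of [z] with the Wirtinger
    derivatives [mu] cancels these constants and gives a first integral of the
    full system ([first_integral_of_const]).

    All derivatives involved are derivatives along real lines, so the calculus
    reduces to that of pairs of functions of one real variable ([has_partial]).
    The regularity class [C1_on] includes continuity of the function itself,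
    because the product rule produces products of functions with partial
    derivatives, whose continuity has to be known. *)

(** * Real and imaginary parts *)

Section ReIm.
Context {R : realType}.
Implicit Types x y : R[i].

Lemma Re_mul x y : complex.Re (x * y) =
  complex.Re x * complex.Re y - complex.Im x * complex.Im y.
Proof. by case: x y => ? ? []. Qed.

Lemma Im_mul x y : complex.Im (x * y) =
  complex.Re x * complex.Im y + complex.Im x * complex.Re y.
Proof. by case: x y => ? ? []. Qed.

Lemma Re_add x y : complex.Re (x + y) = complex.Re x + complex.Re y.
Proof. by case: x y => ? ? []. Qed.

Lemma Im_add x y : complex.Im (x + y) = complex.Im x + complex.Im y.
Proof. by case: x y => ? ? []. Qed.

Lemma sqr_normc_neq0 x : x != 0 -> complex.Re x ^+ 2 + complex.Im x ^+ 2 != 0.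
Proof.
by apply: contra; case: x => a b /=; rewrite paddr_eq0 ?sqr_ge0// !sqrf_eq0 eq_complex.
Qed.

Lemma Re_inv x : complex.Re x^-1 =
  complex.Re x / (complex.Re x ^+ 2 + complex.Im x ^+ 2).
Proof. by case: x. Qed.

Lemma Im_inv x : complex.Im x^-1 =
  - complex.Im x / (complex.Re x ^+ 2 + complex.Im x ^+ 2).
Proof. by case: x => ? ? /=; rewrite mulNr. Qed.
End ReIm.

(** * Derivatives of complex-valued functions along real lines *)

(** The relational form of [partial]: it also records that both components are
    derivable, without which the value of [partial] says nothing. *)
Definition has_partial {R : realType} {N : nat} (v : 'cV[R[i]]_N)
    (f : 'cV[R[i]]_N -> R[i]) (w : 'cV[R[i]]_N) (d : R[i]) : Prop :=
  is_derive (0 : R) (1 : R) (line_re f v w) (complex.Re d) /\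
  is_derive (0 : R) (1 : R) (line_im f v w) (complex.Im d).

Section PartialCalculus.
Context {R : realType} {N : nat}.
Implicit Types (f g : 'cV[R[i]]_N -> R[i]) (v w : 'cV[R[i]]_N) (d e : R[i]).

Lemma line0 v w : w + (0 : R)%:C%C *: v = w.
Proof. by rewrite scale0r addr0. Qed.

Lemma has_partialE v f w d : has_partial v f w d -> partial v f w = d.
Proof.
case: d => x y [/= hx hy].
by rewrite /partial !derive1E !derive_val.
Qed.

Lemma has_partial_mul v f g w d e : has_partial v f w d -> has_partial v g w e ->
  has_partial v (fun x => f x * g x) w (d * g w + f w * e).
Proof.
case=> hfr hfi [hgr hgi]; split.
- have -> : line_re (fun x => f x * g x) v w =
            line_re f v w * line_re g v w - line_im f v w * line_im g v w.
    by apply/funext => t; rewrite /line_re Re_mul.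
  apply: is_derive_eq.
  rewrite /line_re /line_im line0 Re_add !Re_mul /GRing.scale /=; ring.
- have -> : line_im (fun x => f x * g x) v w =
            line_re f v w * line_im g v w + line_im f v w * line_re g v w.
    by apply/funext => t; rewrite /line_im Im_mul.
  apply: is_derive_eq.
  rewrite /line_re /line_im line0 Im_add !Im_mul /GRing.scale /=; ring.
Qed.

Lemma has_partial_add v f g w d e : has_partial v f w d -> has_partial v g w e ->
  has_partial v (fun x => f x + g x) w (d + e).
Proof.
case=> hfr hfi [hgr hgi]; split.
- have -> : line_re (fun x => f x + g x) v w = line_re f v w + line_re g v w.
    by apply/funext => t; rewrite /line_re Re_add.
  by rewrite Re_add; exact: is_deriveD.
- have -> : line_im (fun x => f x + g x) v w = line_im f v w + line_im g v w.
    by apply/funext => t; rewrite /line_im Im_add.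
  by rewrite Im_add; exact: is_deriveD.
Qed.

(** Covers constants, linear forms and the zero direction at once. *)
Lemma has_partial_affine v f w d :
  (forall t : R, f (w + t%:C%C *: v) = f w + t%:C%C * d) -> has_partial v f w d.
Proof.
move=> hf; split.
- have -> : line_re f v w = cst (complex.Re (f w)) + (cst (complex.Re d) * id).
    by apply/funext => t; rewrite /line_re hf Re_add Re_mul /= mul0r subr0 mulrC.
  by apply: is_derive_eq; rewrite scaler0 addr0 add0r /GRing.scale /= mulr1.
- have -> : line_im f v w = cst (complex.Im (f w)) + (cst (complex.Im d) * id).
    by apply/funext => t; rewrite /line_im hf Im_add Im_mul /= mul0r addr0 mulrC.
  by apply: is_derive_eq; rewrite scaler0 addr0 add0r /GRing.scale /= mulr1.
Qed.

(** The component [line_re] of [1 / f] is [line_re f] over the squared modulus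
    of [f], a nonvanishing real function, so real derivation rules apply. *)
Lemma has_partial_inv v f w d : f w != 0 -> has_partial v f w d ->
  has_partial v (fun x => (f x)^-1) w (- d * ((f w)^-1 * (f w)^-1)).
Proof.
move=> fw0 [hfr hfi].
set h : R -> R := fun t => line_re f v w t ^+ 2 + line_im f v w t ^+ 2.
have h0 : h 0 != 0 by rewrite /h /line_re /line_im line0 sqr_normc_neq0.
have hd : is_derive (0:R) (1:R) h
    (2 * (line_re f v w 0 * complex.Re d + line_im f v w 0 * complex.Im d)).
  have -> : h = line_re f v w * line_re f v w + line_im f v w * line_im f v w.
    by apply/funext => t; rewrite /h /= !expr2.
  by apply: is_derive_eq; rewrite /GRing.scale /=; ring.
have hV := is_deriveV (f := h) (x := 0) (v := 1) h0.
have h0' := h0; rewrite /h /line_re /line_im line0 in h0'.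
split.
- have -> : line_re (fun x => (f x)^-1) v w = line_re f v w * (fun t => (h t)^-1).
    by apply/funext => t; rewrite /line_re Re_inv.
  apply: is_derive_eq.
  rewrite !(Re_mul, Im_mul, Re_inv, Im_inv) /h /line_re /line_im line0 /GRing.scale /=.
  by move: h0'; case: (f w) d {hfr hfi hd hV} => x y [a b] /= h0'; field.
- have -> : line_im (fun x => (f x)^-1) v w = - line_im f v w * (fun t => (h t)^-1).
    by apply/funext => t; rewrite /line_im Im_inv.
  apply: is_derive_eq.
  rewrite !(Re_mul, Im_mul, Re_inv, Im_inv) /h /line_re /line_im line0 /GRing.scale /=.
  rewrite !fctE /line_im line0.
  by move: h0'; case: (f w) d {hfr hfi hd hV} => x y [a b] /= h0'; field.
Qed.

Lemma real_complex_continuous : continuous (fun t : R => (t%:C%C : R[i])).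
Proof.
move=> t; apply/cvgrPdist_lt => e e0.
have e1 : 0 < complex.Re e by move: e0; rewrite ltcE => /andP[].
have -> : e = (complex.Re e)%:C%C by rewrite RRe_real // gtr0_real.
near=> u; rewrite -rmorphB normc_def /= expr0n addr0 sqrtr_sqr ltcR.
near: u; exact: (@cvgr_dist_lt _ _ _ _ _ id t cvg_id).
Unshelve. all: by end_near. Qed.

Lemma conjC_continuous : continuous (fun x : R[i] => x^*).
Proof.
move=> x; apply/(@cvgrPdist_lt _ R[i] _ (nbhs x)) => e e0.
by exists e => //= y /=; rewrite -rmorphB norm_conjC.
Qed.

Lemma line_continuous v w : continuous (fun t : R => w + t%:C%C *: v).
Proof.
move=> t.
apply: cvgD; first exact: cvg_cst.
by apply: cvgZr_tmp; exact: real_complex_continuous.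
Qed.

Lemma has_partial_near v f g w d :
  (\near w, f w = g w) -> has_partial v f w d -> has_partial v g w d.
Proof.
move=> fg [hr hi].
have fgl : \forall t \near (0 : R), f (w + t%:C%C *: v) = g (w + t%:C%C *: v).
  have fg0 : \forall x \near w + (0 : R)%:C%C *: v, f x = g x.
    by rewrite line0.
  exact: (line_continuous v w 0 _ fg0).
split; [move: hr|move: hi]; apply: near_eq_is_derive;
  by apply: filterS fgl => t; rewrite /line_re /line_im => ->.
Qed.

Lemma C1_along_has_partial v f w : C1_along v f w -> has_partial v f w (partial v f w).
Proof.
case=> hr hi _; rewrite /partial !derive1E; split; exact/derivableP.
Qed.

(** Continuity of [partial v f] at [w] involves its values near [w], hence the
    hypothesis on a neighbourhood and not only at [w]. *)
Lemma C1_alongP v f w (df : 'cV[R[i]]_N -> R[i]) :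
  (\forall x \near w, has_partial v f x (df x)) -> {for w, continuous df} ->
  C1_along v f w.
Proof.
move=> hf cdf; have [hr hi] := nbhs_singleton hf; split.
- exact: (@ex_derive _ _ _ _ _ _ _ hr).
- exact: (@ex_derive _ _ _ _ _ _ _ hi).
- have e : {near w, df =1 partial v f}.
    by apply: filterS hf => x /has_partialE ->.
  have pw := has_partialE _ _ _ _ (nbhs_singleton hf).
  move: cdf; rewrite /prop_for /continuous_at -pw => cdf.
  exact: cvg_trans (near_eq_cvg e) cdf.
Qed.
End PartialCalculus.

(** * Continuously differentiable functions on an open set *)

(** All directions occur, not only the coordinate ones, so that composition with
    a linear projection stays in the class. *)
Definition C1_on {R : realType} {N : nat} (U : set 'cV[R[i]]_N)
    (f : 'cV[R[i]]_N -> R[i]) : Prop :=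
  forall w, U w -> {for w, continuous f} /\ forall v, C1_along v f w.

Section C1Calculus.
Context {R : realType} {N : nat}.
Implicit Types (f g : 'cV[R[i]]_N -> R[i]) (v w : 'cV[R[i]]_N) (U : set 'cV[R[i]]_N).

Lemma C1_on_Rdifferentiable U f : C1_on U f -> Rdifferentiable U f.
Proof. by move=> hf w Uw i; have [_ h] := hf w Uw; split; exact: h. Qed.

Lemma C1_on_has_partial U f v w : C1_on U f -> U w ->
  has_partial v f w (partial v f w).
Proof. by move=> hf Uw; have [_ h] := hf w Uw; apply: C1_along_has_partial. Qed.

(** The way regularity is established below: exhibit an explicit, continuous
    family of directional derivatives. *)
Lemma C1_on_intro U f (df : 'cV[R[i]]_N -> 'cV[R[i]]_N -> R[i]) : open U ->
  (forall w, U w -> {for w, continuous f}) ->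
  (forall v w, U w -> has_partial v f w (df v w)) ->
  (forall v w, U w -> {for w, continuous (df v)}) -> C1_on U f.
Proof.
move=> oU cf hf cdf w Uw; split=> [|v]; first exact: cf.
apply: (@C1_alongP _ _ _ _ _ (df v)); last exact: cdf.
by apply: filterS (open_nbhs_nbhs (conj oU Uw)) => x Ux; exact: hf.
Qed.

Lemma continuous_mulC f g w : {for w, continuous f} -> {for w, continuous g} ->
  {for w, continuous (fun x => f x * g x)}.
Proof. exact: (@cvgM R[i] _ (nbhs w) (nbhs_filter w)). Qed.

Lemma continuous_addC f g w : {for w, continuous f} -> {for w, continuous g} ->
  {for w, continuous (fun x => f x + g x)}.
Proof. exact: (@cvgD R[i] R[i] _ (nbhs w) (nbhs_filter w)). Qed.

Lemma continuous_oppC f w : {for w, continuous f} ->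
  {for w, continuous (fun x => - f x)}.
Proof. exact: (@cvgN R[i] R[i] _ (nbhs w) (nbhs_filter w)). Qed.

Lemma continuous_invC f w : f w != 0 -> {for w, continuous f} ->
  {for w, continuous (fun x => (f x)^-1)}.
Proof. exact: (@cvgV R[i] _ (nbhs w) (nbhs_filter w)). Qed.

Lemma continuous_cstC (c : R[i]) w : {for w, continuous (fun _ : 'cV[R[i]]_N => c)}.
Proof. exact: (@cst_continuous _ R[i] c w). Qed.

Lemma C1_on_cont U f w : C1_on U f -> U w -> {for w, continuous f}.
Proof. by move=> hf Uw; have [cf _] := hf w Uw. Qed.

Lemma C1_on_cont_partial U f v w : C1_on U f -> U w -> {for w, continuous (partial v f)}.
Proof. by move=> hf Uw; have [_ /(_ v)[]] := hf w Uw. Qed.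

Lemma C1_on_eq U f g : open U -> C1_on U g -> (forall x, U x -> f x = g x) ->
  C1_on U f.
Proof.
move=> oU hg fg.
have near_gf w : U w -> {near w, g =1 f}.
  by move=> Uw; apply: filterS (open_nbhs_nbhs (conj oU Uw)) => x /fg.
apply: (C1_on_intro _ _ (fun v w => partial v g w) oU) => [w Uw|v w Uw|v w Uw].
- have cg := C1_on_cont _ _ _ hg Uw.
  move: cg; rewrite /prop_for /continuous_at -(fg w Uw).
  exact: cvg_trans (near_eq_cvg (near_gf w Uw)).
- exact: has_partial_near (near_gf w Uw) (C1_on_has_partial _ _ _ _ hg Uw).
- exact: C1_on_cont_partial hg Uw.
Qed.

Lemma C1_on_add U f g : open U -> C1_on U f -> C1_on U g ->
  C1_on U (fun w => f w + g w).
Proof.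
move=> oU hf hg.
apply: (C1_on_intro _ _ (fun v w => partial v f w + partial v g w) oU)
  => [w Uw|v w Uw|v w Uw].
- by apply: continuous_addC; apply: C1_on_cont Uw.
- by apply: has_partial_add; apply: C1_on_has_partial Uw.
- by apply: continuous_addC; apply: C1_on_cont_partial Uw.
Qed.

Lemma C1_on_mul U f g : open U -> C1_on U f -> C1_on U g ->
  C1_on U (fun w => f w * g w).
Proof.
move=> oU hf hg.
apply: (C1_on_intro _ _ (fun v w => partial v f w * g w + f w * partial v g w) oU)
  => [w Uw|v w Uw|v w Uw].
- by apply: continuous_mulC; apply: C1_on_cont Uw.
- by apply: has_partial_mul; apply: C1_on_has_partial Uw.
- by apply: continuous_addC; apply: continuous_mulC;
    (apply: C1_on_cont_partial Uw || apply: C1_on_cont Uw).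
Qed.

Lemma C1_on_inv U f : open U -> (forall w, U w -> f w != 0) -> C1_on U f ->
  C1_on U (fun w => (f w)^-1).
Proof.
move=> oU f0 hf.
apply: (C1_on_intro _ _ (fun v w => - partial v f w * ((f w)^-1 * (f w)^-1)) oU)
  => [w Uw|v w Uw|v w Uw].
- by apply: continuous_invC; [exact: f0|apply: C1_on_cont Uw].
- by apply: has_partial_inv; [exact: f0|apply: C1_on_has_partial Uw].
- apply: continuous_mulC; first by apply: continuous_oppC; apply: C1_on_cont_partial Uw.
  by apply: continuous_mulC; apply: continuous_invC; (try exact: f0);
    apply: C1_on_cont Uw.
Qed.

Lemma C1_on_cst U (c : R[i]) : open U -> C1_on U (fun _ => c).
Proof.
move=> oU.
apply: (C1_on_intro _ _ (fun v w => 0) oU) => [w _|v w _|v w _];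
  try exact: continuous_cstC.
by apply: has_partial_affine => t; rewrite mulr0 addr0.
Qed.

End C1Calculus.

(** * Real-linear forms *)

Section LinearForms.
Context {R : realType} {N : nat}.
Implicit Types (v w : 'cV[R[i]]_N) (U : set 'cV[R[i]]_N)
  (nu mu : 'cV[R[i]]_(N + N)) (i : 'I_N).

Lemma linformE nu w : linform nu w =
  \sum_(i < N) (nu (lshift N i) 0 * w i 0 + nu (rshift N i) 0 * (w i 0)^*).
Proof.
rewrite /linform big_split_ord big_split /=; congr (_ + _); apply: eq_bigr => i _.
  by rewrite /gamma col_mxEu.
by rewrite /gamma col_mxEd mxE.
Qed.

Lemma linform_real_linear nu v w (t : R) :
  linform nu (w + t%:C%C *: v) = linform nu w + t%:C%C * linform nu v.
Proof.
rewrite !linformE mulr_sumr -big_split; apply: eq_bigr => i _ /=.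
rewrite !mxE rmorphD rmorphM /= (_ : (t%:C%C)^* = t%:C%C); last exact: conjc_real.
ring.
Qed.

Lemma linform_continuous nu : continuous (linform nu).
Proof.
rewrite (_ : linform nu = fun w =>
  \sum_(i < N) (nu (lshift N i) 0 * w i 0 + nu (rshift N i) 0 * (w i 0)^*)); last first.
  by apply/funext => w; exact: linformE.
move=> w.
elim: (index_enum _) => [|i r IH].
  under eq_fun do rewrite big_nil.
  exact: continuous_cstC.
under eq_fun do rewrite big_cons.
have ci : {for w, continuous (fun x : 'cV[R[i]]_N => x i 0)} by exact: coord_continuous.
have cj : {for w, continuous (fun x : 'cV[R[i]]_N => (x i 0)^*)}.
  exact: (continuous_comp ci (@conjC_continuous R _)).
apply: continuous_addC IH; apply: continuous_addC.
- exact: continuous_mulC (continuous_cstC _ _) ci.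
- exact: continuous_mulC (continuous_cstC _ _) cj.
Qed.

Lemma C1_on_linform U nu : open U -> C1_on U (linform nu).
Proof.
move=> oU.
apply: (C1_on_intro _ _ (fun v w => linform nu v) oU) => [w _|v w _|v w _].
- exact: linform_continuous.
- by apply: has_partial_affine => t; exact: linform_real_linear.
- exact: continuous_cstC.
Qed.

Lemma partial_linform nu v w : partial v (linform nu) w = linform nu v.
Proof.
by apply/has_partialE/has_partial_affine => t; exact: linform_real_linear.
Qed.

Lemma linform_dir_x nu i : linform nu (dir_x i) = nu (lshift N i) 0 + nu (rshift N i) 0.
Proof.
rewrite linformE (bigD1 i)//= big1 ?addr0 => [|j ji].
  by rewrite !mxE !eqxx conjC1 !mulr1.
by rewrite !mxE (negbTE ji) conjC0 !mulr0 addr0.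
Qed.

Lemma linform_dir_y nu i : linform nu (dir_y i) =
  'i%C * (nu (lshift N i) 0 - nu (rshift N i) 0).
Proof.
have iJ : ('i%C : R[i])^* = - 'i%C by apply/eqP; rewrite eq_complex /= oppr0 !eqxx.
rewrite linformE (bigD1 i)//= big1 ?addr0 => [|j ji].
  by rewrite !mxE !eqxx mulr1 iJ; ring.
by rewrite !mxE (negbTE ji) mulr0 conjC0 !mulr0 addr0.
Qed.

Lemma d_w_linform nu i w : d_w i (linform nu) w = nu (lshift N i) 0.
Proof.
rewrite /d_w !partial_linform linform_dir_x linform_dir_y mulrA -expr2 sqr_i mulN1r.
by field.
Qed.

Lemma d_wbar_linform nu i w : d_wbar i (linform nu) w = nu (rshift N i) 0.
Proof.
rewrite /d_wbar !partial_linform linform_dir_x linform_dir_y mulrA -expr2 sqr_i mulN1r.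
by field.
Qed.

(** The coefficients are recovered as Wirtinger derivatives; this is the
    linear independence of [w] and its conjugate over the complex numbers. *)
Lemma linform_eq0 nu : (forall w, linform nu w = 0) -> nu = 0.
Proof.
move=> h; apply/matrixP => r j; rewrite ord1 mxE.
have p0 v w : partial v (linform nu) w = 0 by rewrite partial_linform h.
case: (split_ordP r) => i ->.
  by rewrite -(d_w_linform _ _ 0) /d_w !p0 mulr0 subr0 mulr0.
by rewrite -(d_wbar_linform _ _ 0) /d_wbar !p0 mulr0 addr0 mulr0.
Qed.

Lemma linformB nu mu w : linform (nu - mu) w = linform nu w - linform mu w.
Proof.
by rewrite /linform -sumrB; apply: eq_bigr => r _; rewrite !mxE mulrBl.
Qed.

Lemma linformD nu mu w : linform (nu + mu) w = linform nu w + linform mu w.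
Proof.
by rewrite /linform -big_split; apply: eq_bigr => r _; rewrite !mxE mulrDl.
Qed.

Lemma linformZ c nu w : linform (c *: nu) w = c * linform nu w.
Proof.
by rewrite /linform mulr_sumr; apply: eq_bigr => r _; rewrite !mxE mulrA.
Qed.
End LinearForms.

(** * The operators as commuting derivations *)

Section Operators.
Context {R : realType} {m n : nat}.
Variable a : 'I_n -> 'I_(m + m) -> 'cV[R[i]]_(n + n).
Implicit Types (f g h : 'cV[R[i]]_n -> R[i]) (w : 'cV[R[i]]_n)
  (U : set 'cV[R[i]]_n) (nu : 'cV[R[i]]_(n + n)) (k l : 'I_(m + m)) (c d : R[i]).

(** [op_x a k] is linear in the family of directional derivatives; every
    derivation rule below is an instance, with the values at [w] as coefficients. *)
Lemma op_x_comb k f g h w c d :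
  (forall v, partial v h w = c * partial v f w + d * partial v g w) ->
  op_x a k h w = c * op_x a k f w + d * op_x a k g w.
Proof.
move=> hp; rewrite /op_x !mulr_sumr -big_split; apply: eq_bigr => xi _ /=.
rewrite /d_w /d_wbar !hp.
move: (Defs.coefX _ _ _ _) ((Defs.coefX _ _ _ _)^*) (partial _ f w) (partial _ f w)
  (partial _ g w) (partial _ g w) => X Y p q r s.
by ring.
Qed.

Lemma op_x_cst k c w : op_x a k (fun _ => c) w = 0.
Proof.
rewrite (op_x_comb k (fun _ => c) (fun _ => c) (fun _ => c) w 0 0).
  by rewrite !mul0r addr0.
move=> v; rewrite !mul0r addr0; apply/has_partialE/has_partial_affine => t.
by rewrite mulr0 addr0.
Qed.

Lemma op_x_eq U k f g w : open U -> C1_on U g -> (forall x, U x -> f x = g x) ->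
  U w -> op_x a k f w = op_x a k g w.
Proof.
move=> oU hg fg Uw.
rewrite (op_x_comb k g g f w 1 0) ?mul1r ?mul0r ?addr0// => v.
rewrite mul1r mul0r addr0.
apply: has_partialE; apply: has_partial_near (C1_on_has_partial _ _ v _ hg Uw).
by apply: filterS (open_nbhs_nbhs (conj oU Uw)) => x /fg.
Qed.

Lemma op_x_add U k f g w : C1_on U f -> C1_on U g -> U w ->
  op_x a k (fun x => f x + g x) w = op_x a k f w + op_x a k g w.
Proof.
move=> hf hg Uw.
rewrite (op_x_comb k f g _ w 1 1) ?mul1r// => v; rewrite !mul1r.
by apply: has_partialE; apply: has_partial_add; apply: C1_on_has_partial Uw.
Qed.

Lemma op_x_mul U k f g w : C1_on U f -> C1_on U g -> U w ->
  op_x a k (fun x => f x * g x) w = op_x a k f w * g w + f w * op_x a k g w.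
Proof.
move=> hf hg Uw.
rewrite (op_x_comb k f g _ w (g w) (f w)) 1?mulrC// => v; rewrite [g w * _]mulrC.
by apply: has_partialE; apply: has_partial_mul; apply: C1_on_has_partial Uw.
Qed.

Lemma op_x_inv U k f w : C1_on U f -> f w != 0 -> U w ->
  op_x a k (fun x => (f x)^-1) w = - op_x a k f w * ((f w)^-1 * (f w)^-1).
Proof.
move=> hf fw0 Uw.
rewrite (op_x_comb k f f _ w (- ((f w)^-1 * (f w)^-1)) 0) => [|v].
  by rewrite mul0r addr0 mulNr mulrC mulNr.
rewrite mul0r addr0 mulNr mulrC -mulNr.
exact: has_partialE (has_partial_inv _ _ _ _ fw0 (C1_on_has_partial _ _ _ _ hf Uw)).
Qed.

Lemma coefX_linform xi k w : Defs.coefX a xi k w = linform (a xi k) w.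
Proof. by rewrite linformE. Qed.

Lemma conj_linform nu w : (linform nu w)^* = linform (conj_col nu) w.
Proof.
rewrite !linformE rmorph_sum; apply: eq_bigr => i _.
by rewrite rmorphD !rmorphM /= conjCK /conj_col col_mxEu col_mxEd !mxE addrC.
Qed.

Lemma op_x_linform k nu w : op_x a k (linform nu) w = linform (mxA a k *m nu) w.
Proof.
rewrite {2}/linform /op_x.
under eq_bigr => xi _ do
  rewrite d_w_linform d_wbar_linform !coefX_linform conj_linform /linform !mulr_suml.
under [RHS]eq_bigr => r _ do
  rewrite mxE big_split_ord /= mulrDl !mulr_suml.
rewrite !big_split /=; congr (_ + _); rewrite exchange_big /=; apply: eq_bigr => r _;
  apply: eq_bigr => xi _; rewrite /mxA ?row_mxEl ?row_mxEr mxE; ring.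
Qed.

Lemma twice_Rdifferentiable_linform nu : twice_Rdifferentiable setT (linform nu).
Proof.
split; first by apply: C1_on_Rdifferentiable; apply: C1_on_linform; exact: openT.
have pc v : partial v (linform nu) = fun _ => linform nu v.
  by apply/funext => w; exact: partial_linform.
by move=> i; rewrite !pc; split; apply: C1_on_Rdifferentiable; apply: C1_on_cst;
  exact: openT.
Qed.

(** On a linear form the commutator of the operators is the linear form of the
    commutator of the matrices, and linear forms determine their coefficients. *)
Lemma completely_solvable_commute : completely_solvable a ->
  forall k l nu, mxA a k *m (mxA a l *m nu) = mxA a l *m (mxA a k *m nu).
Proof.
move=> hs k l nu; apply/eqP; rewrite -subr_eq0; apply/eqP/linform_eq0 => w.
have op_lin j mu : op_x a j (linform mu) = linform (mxA a j *m mu).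
  by apply/funext => x; exact: op_x_linform.
by rewrite linformB -(hs k l _ (twice_Rdifferentiable_linform nu) w) !op_lin.
Qed.

(** The functions on which the operators commute, with the regularity that the
    derivation rules need for one application of each operator.  Commutation is
    only available globally from complete solvability, whereas the functions of
    interest live on [U]; this class carries it over by closure properties. *)
Definition commuting U f :=
  [/\ C1_on U f, forall k, C1_on U (op_x a k f) &
    forall k l w, U w -> op_x a k (op_x a l f) w = op_x a l (op_x a k f) w].

(** Replaces [op_x a k f], known only through its values on [U], by an explicit
    function [xf k]. *)
Lemma commuting_intro U f (xf : 'I_(m + m) -> 'cV[R[i]]_n -> R[i]) :
  open U -> C1_on U f ->
  (forall k w, U w -> op_x a k f w = xf k w) -> (forall k, C1_on U (xf k)) ->
  (forall k l w, U w -> op_x a k (xf l) w = op_x a l (xf k) w) ->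
  commuting U f.
Proof.
move=> oU hf hxf cxf comm; split; first exact: hf.
  by move=> k; exact: C1_on_eq oU (cxf k) (hxf k).
move=> k l w Uw.
rewrite (op_x_eq U k _ _ w oU (cxf l) (hxf l) Uw).
rewrite (op_x_eq U l _ _ w oU (cxf k) (hxf k) Uw).
exact: comm.
Qed.

Lemma commuting_eq U f g : open U -> (forall w, U w -> f w = g w) ->
  commuting U g -> commuting U f.
Proof.
move=> oU fg [cg cxg comm].
apply: (commuting_intro U f (fun k => op_x a k g) oU (C1_on_eq _ _ _ oU cg fg) _
  cxg comm).
by move=> k w Uw; exact: op_x_eq oU cg fg Uw.
Qed.

Lemma commuting_cst U c : open U -> commuting U (fun _ => c).
Proof.
move=> oU.
apply: (commuting_intro U _ (fun _ _ => 0) oU (C1_on_cst U c oU)) => [k w _|k|k l w _].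
- exact: op_x_cst.
- exact: C1_on_cst.
- by rewrite !op_x_cst.
Qed.

Lemma commuting_add U f g : open U -> commuting U f -> commuting U g ->
  commuting U (fun w => f w + g w).
Proof.
move=> oU [cf cxf hf] [cg cxg hg].
apply: (commuting_intro U _ (fun k w => op_x a k f w + op_x a k g w) oU
  (C1_on_add _ _ _ oU cf cg)) => [k w Uw|k|k l w Uw].
- exact: op_x_add cf cg Uw.
- exact: C1_on_add oU (cxf k) (cxg k).
- rewrite (op_x_add _ _ _ _ _ (cxf l) (cxg l) Uw) (op_x_add _ _ _ _ _ (cxf k) (cxg k) Uw).
  by rewrite (hf k l w Uw) (hg k l w Uw).
Qed.

(** In the second-order Leibniz rule the mixed terms are symmetric in [k], [l]. *)
Lemma commuting_mul U f g : open U -> commuting U f -> commuting U g ->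
  commuting U (fun w => f w * g w).
Proof.
move=> oU [cf cxf hf] [cg cxg hg].
have c1 k := C1_on_mul _ _ _ oU (cxf k) cg.
have c2 k := C1_on_mul _ _ _ oU cf (cxg k).
apply: (commuting_intro U _ (fun k w => op_x a k f w * g w + f w * op_x a k g w) oU
  (C1_on_mul _ _ _ oU cf cg)) => [k w Uw|k|k l w Uw].
- exact: op_x_mul cf cg Uw.
- exact: C1_on_add oU (c1 k) (c2 k).
- rewrite (op_x_add _ _ _ _ _ (c1 l) (c2 l) Uw) (op_x_add _ _ _ _ _ (c1 k) (c2 k) Uw).
  rewrite !(op_x_mul _ _ _ _ _ (cxf _) cg Uw) !(op_x_mul _ _ _ _ _ cf (cxg _) Uw).
  rewrite (hf k l w Uw) (hg k l w Uw).
  move: (op_x _ k f w) (op_x _ l f w) (op_x _ _ (op_x _ _ f) w) => ? ? ?.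
  move: (op_x _ k g w) (op_x _ l g w) (op_x _ _ (op_x _ _ g) w) => ? ? ?.
  by ring.
Qed.

Lemma commuting_inv U f : open U -> (forall w, U w -> f w != 0) -> commuting U f ->
  commuting U (fun w => (f w)^-1).
Proof.
move=> oU f0 [cf cxf hf].
have cV := C1_on_inv _ _ oU f0 cf.
have cVV := C1_on_mul _ _ _ oU cV cV.
have c1 := C1_on_cst U (-1) oU.
have cN k := C1_on_mul _ _ _ oU c1 (cxf k).
(* The factor [-1] is a constant function, so that the product rule is the only
   derivation rule needed on [- op_x a k f]. *)
apply: (commuting_intro U _
  (fun k w => (-1 * op_x a k f w) * ((f w)^-1 * (f w)^-1)) oU cV) => [k w Uw|k|k l w Uw].
- by rewrite (op_x_inv _ _ _ _ cf (f0 w Uw) Uw) mulN1r.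
- exact: C1_on_mul oU (cN k) cVV.
- rewrite !(op_x_mul _ _ _ _ _ (cN _) cVV Uw) !(op_x_mul _ _ _ _ _ c1 (cxf _) Uw).
  rewrite !op_x_cst.
  rewrite !(op_x_mul _ _ _ _ _ cV cV Uw) !(op_x_inv _ _ _ _ cf (f0 w Uw) Uw).
  rewrite (hf k l w Uw).
  move: (op_x _ k f w) (op_x _ l f w) (op_x _ _ (op_x _ _ _) w) (f w)^-1 => ? ? ? ?.
  by ring.
Qed.

Lemma commuting_linform U nu : open U ->
  (forall k l, mxA a k *m (mxA a l *m nu) = mxA a l *m (mxA a k *m nu)) ->
  commuting U (linform nu).
Proof.
move=> oU comm.
apply: (commuting_intro U _ (fun k w => linform (mxA a k *m nu) w) oU
  (C1_on_linform _ _ oU)) => [k w _|k|k l w _].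
- exact: op_x_linform.
- exact: C1_on_linform.
- by rewrite !op_x_linform comm.
Qed.

Lemma commuting_sum U (r : seq nat) (F : nat -> 'cV[R[i]]_n -> R[i]) : open U ->
  (forall i, i \in r -> commuting U (F i)) ->
  commuting U (fun w => \sum_(i <- r) F i w).
Proof.
move=> oU; elim: r => [|i r IH] hF.
  by under eq_fun do rewrite big_nil; exact: commuting_cst.
under eq_fun do rewrite big_cons.
apply: (commuting_add _ _ _ oU (hF i (mem_head _ _))).
by apply: IH => j jr; apply: hF; rewrite in_cons jr orbT.
Qed.

Lemma op_x_sum U k (r : seq nat) (F : nat -> 'cV[R[i]]_n -> R[i]) w : open U -> U w ->
  (forall i, i \in r -> commuting U (F i)) ->
  op_x a k (fun w => \sum_(i <- r) F i w) w = \sum_(i <- r) op_x a k (F i) w.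
Proof.
move=> oU Uw; elim: r => [|i r IH] hF.
  by under eq_fun do rewrite big_nil; rewrite big_nil op_x_cst.
under eq_fun do rewrite big_cons.
have hr j : j \in r -> commuting U (F j) by move=> jr; apply: hF; rewrite in_cons jr orbT.
have [ci _ _] := hF i (mem_head _ _).
have [cr _ _] := commuting_sum U r F oU hr.
by rewrite (op_x_add _ _ _ _ _ ci cr Uw) big_cons (IH hr).
Qed.

End Operators.

(** * Adding the independent variables *)

(** Neighbourhoods of a matrix are generated by boxes: extend a box by no
    constraint on the upper rows. *)
Lemma dsubmx_continuous {R : realType} m n : continuous (@dsubmx R[i] m n 1).
Proof.
move=> p A [P hP PA].
exists (fun r j x => forall i, r = rshift m i -> P i j x).
- move=> r j; case: (split_ordP r) => i ->.
    apply: filterS (@filterT _ (nbhs (p (lshift n i) j)) _) => x _ k /eqP.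
    by rewrite eq_lrshift.
  have := hP i j; rewrite mxE; apply: filterS => x Px k /rshift_inj <-; exact: Px.
- move=> q hq; apply: PA => i j; rewrite mxE; exact: hq.
Qed.

Section Extension.
Context {R : realType} {m n : nat}.
Implicit Types (f : 'cV[R[i]]_n -> R[i]) (p v : 'cV[R[i]]_(m + n)).

Lemma has_partial_dsubmx f v p d : has_partial (dsubmx v) f (dsubmx p) d ->
  has_partial v (fun q => f (dsubmx q)) p d.
Proof.
move=> [hr hi]; split.
- have -> // : line_re (fun q => f (dsubmx q)) v p = line_re f (dsubmx v) (dsubmx p).
  by apply/funext => t; rewrite /line_re linearD linearZ.
- have -> // : line_im (fun q => f (dsubmx q)) v p = line_im f (dsubmx v) (dsubmx p).
  by apply/funext => t; rewrite /line_im linearD linearZ.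
Qed.

Lemma C1_on_dsubmx (U : set 'cV[R[i]]_n) (G : set 'cV[R[i]]_(m + n)) f :
  open G -> G `<=` [set p | U (dsubmx p)] -> C1_on U f ->
  C1_on G (fun p => f (dsubmx p)).
Proof.
move=> oG GU hf.
have cd p := @dsubmx_continuous R m n p.
apply: (C1_on_intro _ _ (fun v p => partial (dsubmx v) f (dsubmx p)) oG)
  => [p Gp|v p Gp|v p Gp].
- exact: (continuous_comp (cd p) (C1_on_cont _ _ _ hf (GU p Gp))).
- exact: has_partial_dsubmx (C1_on_has_partial _ _ _ _ hf (GU p Gp)).
- exact: (continuous_comp (cd p) (C1_on_cont_partial _ _ _ _ hf (GU p Gp))).
Qed.

Variable a : 'I_n -> 'I_(m + m) -> 'cV[R[i]]_(n + n).

(** The sum is minus the linear form of [kappa], so its Wirtinger derivatives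
    can be read off from the coefficients; it does not depend on [w], hence
    [op_x] does not see it. *)
Lemma first_integral_of_const (U : set 'cV[R[i]]_n) (mu : 'I_(m + m) -> R[i]) f :
  open U -> C1_on U f -> (forall k w, U w -> op_x a k f w = mu k) ->
  forall G : set 'cV[R[i]]_(m + n), open G -> G `<=` [set p | U (dsubmx p)] ->
  first_integral a G (fun p => f (dsubmx p) -
    \sum_(j < m) (mu (lshift m j) * usubmx p j 0 + mu (rshift m j) * (usubmx p j 0)^*)).
Proof.
move=> oU cf hmu G oG GU.
pose kappa : 'cV[R[i]]_((m + n) + (m + n)) :=
  col_mx (col_mx (\col_j - mu (lshift m j)) 0) (col_mx (\col_j - mu (rshift m j)) 0).
have Fe p : f (dsubmx p) - \sum_(j < m) (mu (lshift m j) * usubmx p j 0 +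
    mu (rshift m j) * (usubmx p j 0)^*) = f (dsubmx p) + linform kappa p.
  congr (_ + _); rewrite linformE big_split_ord /= [X in _ = _ + X]big1 => [|j _].
    rewrite addr0 -sumrN; apply: eq_bigr => j _.
    by rewrite !(col_mxEu, col_mxEd) !mxE opprD !mulNr.
  by rewrite !(col_mxEu, col_mxEd) !mxE !mul0r addr0.
have cG := C1_on_dsubmx U G f oG GU cf.
have cL := C1_on_linform G kappa oG.
split.
  under eq_fun do rewrite Fe.
  exact: C1_on_Rdifferentiable (C1_on_add _ _ _ oG cG cL).
move=> k p Gp.
have Up := GU p Gp.
have opE : op_x a k (fun w => f (dsubmx (col_mx (usubmx p) w)) -
    \sum_(j < m) (mu (lshift m j) * usubmx (col_mx (usubmx p) w) j 0 +
    mu (rshift m j) * (usubmx (col_mx (usubmx p) w) j 0)^*)) (dsubmx p) = mu k.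
  under eq_fun do rewrite col_mxKd col_mxKu.
  rewrite (op_x_add _ _ _ _ _ _ cf (C1_on_cst U _ oU) Up) op_x_cst addr0.
  exact: hmu.
rewrite /op_X opE.
under eq_fun do rewrite Fe.
have part_z v : dsubmx v = 0 ->
    partial v (fun q => f (dsubmx q) + linform kappa q) p = partial v (linform kappa) p.
  move=> v0; rewrite -[RHS]add0r.
  apply: has_partialE; apply: has_partial_add; last exact: C1_on_has_partial cL Gp.
  apply: has_partial_dsubmx; rewrite v0; apply: has_partial_affine => t.
  by rewrite scaler0 mulr0 !addr0.
have dx0 (j : 'I_m) : dsubmx (dir_x (lshift n j) : 'cV[R[i]]_(m + n)) = 0.
  by apply/matrixP => i c; rewrite !mxE eq_rlshift.
have dy0 (j : 'I_m) : dsubmx (dir_y (lshift n j) : 'cV[R[i]]_(m + n)) = 0.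
  by rewrite /dir_y linearZ /= dx0 scaler0.
case: (split_ordP k) => j ->; rewrite ?unsplitK.
- rewrite /d_w !part_z // -/(d_w _ _ _) d_w_linform.
  by rewrite !(col_mxEu, col_mxEd) mxE addNr.
- rewrite /d_wbar !part_z // -/(d_wbar _ _ _) d_wbar_linform.
  by rewrite !(col_mxEu, col_mxEd) mxE addNr.
Qed.
End Extension.

(** * The functions built from the generalized eigenvectors *)

Section Recursion.
Context {R : realType} {m n : nat}.
Variables (a : 'I_n -> 'I_(m + m) -> 'cV[R[i]]_(n + n)) (s : nat)
  (nu : nat -> 'cV[R[i]]_(n + n)) (U : set 'cV[R[i]]_n)
  (Psi : nat -> 'cV[R[i]]_n -> R[i]).
Hypotheses (oU : open U)
  (commA : forall k l (x : 'cV[R[i]]_(n + n)),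
     mxA a k *m (mxA a l *m x) = mxA a l *m (mxA a k *m x))
  (nz : forall w, U w -> linform (nu 0%N) w != 0)
  (hPsi : forall eta : nat, (1 <= eta < s)%N -> forall w, U w ->
     linform (nu eta) w =
       \sum_(1 <= delta < eta.+1)
          'C(eta.-1, delta.-1)%:R * Psi delta w * linform (nu (eta - delta)%N) w).

Lemma Psi_solved p w : (p.+1 < s)%N -> U w ->
  Psi p.+1 w = (linform (nu p.+1) w + \sum_(1 <= delta < p.+1)
     (- 'C(p, delta.-1)%:R) * Psi delta w * linform (nu (p.+1 - delta)%N) w) *
     (linform (nu 0%N) w)^-1.
Proof.
move=> ps Uw; apply: (canRL (mulfK (nz w Uw))).
rewrite (hPsi p.+1 ps w Uw) big_nat_recr //= binn subnn mul1r addrAC -big_split /=.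
by rewrite big1 ?add0r// => delta _; rewrite !mulNr addrN.
Qed.

Lemma commuting_Psi eta : (1 <= eta < s)%N -> commuting a U (Psi eta).
Proof.
elim/ltn_ind: eta => -[//|p] IH /= ps.
have cL x : commuting a U (linform x).
  by apply: commuting_linform oU _ => k l; exact: commA.
apply: (commuting_eq _ _ _ _ oU (fun w => Psi_solved p w ps)).
apply: (commuting_mul _ _ _ _ oU); last exact: (commuting_inv _ _ _ oU nz (cL _)).
apply: (commuting_add _ _ _ _ oU (cL _)); apply: (commuting_sum _ _ _ _ oU) => delta.
rewrite mem_index_iota => /andP[d1 dp].
apply: (commuting_mul _ _ _ _ oU _ (cL _)).
apply: (commuting_mul _ _ _ _ oU (commuting_cst _ _ _ oU)).
by apply: IH => //; rewrite d1 (ltn_trans dp).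
Qed.

(** Deriving the defining equation of rank [p + 1], the eigenvalue terms cancel
    by that equation itself.  Since [C(p, d-1) (p+1-d) = p C(p-1, d-1)], the terms
    where the form [nu_(p+1-d)] loses one order add up to [p] times the
    defining equation of rank [p] (both are zero for [p = 0]).  What remains is the triangular system
    [sum_d C(p, d-1) x(Psi_d) nu_(p+1-d) = nu_p], and the sequence 1, 0, 0, ...
    is its solution. *)
Lemma op_x_Psi (k : 'I_(m + m)) (lam : R[i]) :
  (forall eta, (eta < s)%N -> mxA a k *m nu eta = lam *: nu eta + eta%:R *: nu eta.-1) ->
  forall eta, (1 <= eta < s)%N -> forall w, U w -> op_x a k (Psi eta) w = (eta == 1%N)%:R.
Proof.
move=> hnu eta; elim/ltn_ind: eta => -[//|p] IH /= ps w Uw.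
have cL x : commuting a U (linform x).
  by apply: commuting_linform oU _ => ? ?; exact: commA.
have C1L x : C1_on U (linform x) by have [] := cL x.
have opL eta : (eta < s)%N -> op_x a k (linform (nu eta)) w =
    lam * linform (nu eta) w + eta%:R * linform (nu eta.-1) w.
  by move=> es; rewrite op_x_linform hnu // linformD !linformZ.
pose L eta := linform (nu eta) w.
have cterm delta : delta \in index_iota 1 p.+2 -> commuting a U
    (fun x => 'C(p, delta.-1)%:R * Psi delta x * linform (nu (p.+1 - delta)%N) x).
  rewrite mem_index_iota => /andP[d1 dp].
  apply: (commuting_mul _ _ _ _ oU _ (cL _)).
  apply: (commuting_mul _ _ _ _ oU (commuting_cst _ _ _ oU)).
  by apply: commuting_Psi; rewrite d1 (leq_ltn_trans _ ps).
have derived : lam * L p.+1 + p.+1%:R * L p =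
    \sum_(1 <= delta < p.+2)
      ('C(p, delta.-1)%:R * op_x a k (Psi delta) w * L (p.+1 - delta)%N +
       'C(p, delta.-1)%:R * Psi delta w *
         (lam * L (p.+1 - delta)%N + (p.+1 - delta)%:R * L (p.+1 - delta).-1)).
  rewrite -(opL p.+1 ps).
  have [cs _ _] := commuting_sum _ _ _ _ oU cterm.
  rewrite (op_x_eq _ _ _ _ _ _ oU cs (fun x Ux => hPsi p.+1 ps x Ux) Uw).
  rewrite (op_x_sum _ _ _ _ _ _ oU Uw cterm).
  apply: eq_big_nat => delta /andP[d1 dp].
  have [cP _ _] : commuting a U (Psi delta).
    by apply: commuting_Psi; rewrite d1 (leq_ltn_trans _ ps).
  have cc := C1_on_cst U ('C(p, delta.-1)%:R : R[i]) oU.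
  rewrite (op_x_mul _ _ _ _ _ _ (C1_on_mul _ _ _ oU cc cP) (C1L _) Uw).
  rewrite (op_x_mul _ _ _ _ _ _ cc cP Uw) op_x_cst mul0r add0r opL //.
  exact: leq_ltn_trans (leq_subr _ _) ps.
have eqn : L p.+1 = \sum_(1 <= delta < p.+2)
    'C(p, delta.-1)%:R * Psi delta w * L (p.+1 - delta)%N by exact: hPsi.
have lower : \sum_(1 <= delta < p.+2) 'C(p, delta.-1)%:R * Psi delta w *
     ((p.+1 - delta)%:R * L (p.+1 - delta).-1) = p%:R * L p.
  rewrite big_nat_recr //= subnn mul0r mulr0 addr0.
  case: p ps {IH cterm derived eqn} => [|q] qs; first by rewrite big_geq // mul0r.
  rewrite /L (hPsi q.+1 _ w Uw) ?(ltnW qs)// mulr_sumr.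
  apply: eq_big_nat => -[//|j] /= jq.
  rewrite subSS (_ : (q.+1 - j).-1 = q.+1 - j.+1)%N ?subnS//.
  (* The binomial index is shifted: [delta = j + 1]. *)
  have := mul_bin_down q.+1 j; rewrite /= => /(congr1 (fun x : nat => x%:R : R[i])).
  rewrite !natrM => e; rewrite !mulrA -[_ * _ * (_ - _)%:R]mulrA [Psi _ _ * _]mulrC.
  by rewrite mulrA [_ * (q.+1 - j)%:R]mulrC -e.
have top : \sum_(1 <= delta < p.+2)
    'C(p, delta.-1)%:R * op_x a k (Psi delta) w * L (p.+1 - delta)%N = L p.
  move: derived; rewrite big_split /=.
  under [X in _ = _ + X]eq_bigr => delta _ do rewrite mulrDr mulrCA.
  rewrite big_split /= -mulr_sumr -eqn lower => e.
  apply: (addIr (lam * L p.+1 + p%:R * L p)); rewrite -e -natr1.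
  by rewrite mulrDl mul1r [L p + _]addrC addrA.
apply: (mulIf (nz w Uw)).
move: top; rewrite big_nat_recr //= binn subnn mul1r -/(L 0%N).
case: p ps IH {cterm derived eqn lower} => [|q] qs IH /=.
  by rewrite big_geq // add0r mul1r.
rewrite big_ltn // bin0 mul1r IH //=; last exact: ltn_trans qs.
rewrite mul1r subn1 /= big1_seq ?addr0 => [|delta].
  by move=> /eqP; rewrite -subr_eq0 addrAC subrr add0r => /eqP ->; rewrite mul0r.
rewrite mem_index_iota => /andP[_ /andP[d2 dq]].
rewrite IH ?(ltn_trans _ qs)//; last by rewrite (ltnW d2).
by rewrite gtn_eqF // mulr0 mul0r.
Qed.
End Recursion.

(** * First integrals of the full system *)

Theorem theorem1p4 (R : realType) (m n : nat) (hm : (1 <= m)%N) (hn : (1 <= n)%N)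
  (a : 'I_n -> 'I_(m + m) -> 'cV[R[i]]_(n + n))
  (hsolv : completely_solvable a)
  (zeta : 'I_m)
  (hzeta : forall j : 'I_m,
     (nb_elementary_divisors (mxA a (lshift m zeta)) <=
      nb_elementary_divisors (mxA a (lshift m j)))%N)
  (lambda : 'I_(m + m) -> R[i]) (s : nat) (nu : nat -> 'cV[R[i]]_(n + n))
  (hs : (2 <= s)%N)
  (hdiv : elementary_divisor (mxA a (lshift m zeta)) (lambda (lshift m zeta)) s)
  (hnu0 : nu 0%N != 0)
  (heig : forall k : 'I_(m + m), mxA a k *m nu 0%N = lambda k *: nu 0%N)
  (hgen : forall eta : nat, (1 <= eta < s)%N ->
     nu eta != 0 /\
     (mxA a (lshift m zeta) - (lambda (lshift m zeta))%:M) *m nu eta =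
       eta%:R *: nu eta.-1)
  (Omega : set 'cV[R[i]]_n) (hOmega : is_domain Omega)
  (hOmega0 : Omega `<=` [set w | linform (nu 0%N) w != 0])
  (Psi : nat -> 'cV[R[i]]_n -> R[i])
  (hPsi : forall eta : nat, (1 <= eta < s)%N -> forall w, Omega w ->
     linform (nu eta) w =
       \sum_(1 <= delta < eta.+1)
          'C(eta.-1, delta.-1)%:R * Psi delta w * linform (nu (eta - delta)%N) w)
  (hno : forall (k : 'I_(m + m)) (eta : nat), k != lshift m zeta ->
     (1 <= eta < s)%N -> ~ ode_first_integral a zeta Omega (op_x a k (Psi eta))) :
  exists mu : nat -> 'I_(m + m) -> R[i],
    (forall (eta : nat) (k : 'I_(m + m)), (1 <= eta < s)%N ->
       forall w, Omega w -> op_x a k (Psi eta) w = mu eta k) /\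
    (forall eta : nat, (1 <= eta < s)%N ->
       forall G : set 'cV[R[i]]_(m + n), is_domain G ->
       G `<=` [set p | Omega (dsubmx p)] ->
       first_integral a G (fun p : 'cV[R[i]]_(m + n) =>
         Psi eta (dsubmx p) -
         \sum_(j < m) (mu eta (lshift m j) * usubmx p j 0 +
                       mu eta (rshift m j) * (usubmx p j 0)^*))).
Proof.
have [_ oU _] := hOmega.
have commA := completely_solvable_commute a hsolv.
have nz w : Omega w -> linform (nu 0%N) w != 0 by exact: hOmega0.
have hnu eta : (eta < s)%N -> mxA a (lshift m zeta) *m nu eta =
    lambda (lshift m zeta) *: nu eta + eta%:R *: nu eta.-1.
  case: eta => [_|p ps]; first by rewrite heig scale0r addr0.
  have [_ <-] := hgen p.+1 ps.
  by rewrite mulmxBl mul_scalar_mx addrC subrK.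
have cPsi eta : (1 <= eta < s)%N -> commuting a Omega (Psi eta).
  exact: commuting_Psi oU commA nz hPsi eta.
have xzeta := op_x_Psi _ _ _ _ _ oU commA nz hPsi _ _ hnu.
have cst_ex (ek : nat * 'I_(m + m)) : exists c : R[i], (1 <= ek.1 < s)%N ->
    forall w, Omega w -> op_x a ek.2 (Psi ek.1) w = c.
  (* The value 0 is a placeholder: outside the range of [eta] nothing is asked. *)
  case: ek => eta k /=; case: (boolP (1 <= eta < s)%N) => [es|]; last by exists 0.
  have [->|kz] := eqVneq k (lshift m zeta).
    by exists (eta == 1%N)%:R => _; exact: xzeta.
  have [cP cxP comm] := cPsi eta es.
  apply: contrapT => not_cst; apply: (hno k eta kz es); split.
  - exact: C1_on_Rdifferentiable (cxP k).
  - move=> w Uw; rewrite comm //.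
    by rewrite (op_x_eq _ _ _ _ _ _ oU (C1_on_cst _ _ oU) (xzeta eta es) Uw) op_x_cst.
  - by move=> [c hc]; apply: not_cst; exists c.
have [mu hmu] := boolp.choice cst_ex.
exists (fun eta k => mu (eta, k)); split=> [eta k es|eta es G [_ oG _] GU].
  exact: (hmu (eta, k) es).
have [cP _ _] := cPsi eta es.
exact: (first_integral_of_const a Omega (fun k => mu (eta, k)) _ oU cP
  (fun k => hmu (eta, k) es) G oG GU).
Qed.
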